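(* Let $S$ be a non-empty set and let $(X,E)$ be a connected and locally finite symmetric digraph. Let $f\in C^0_{\mathrm{unif}}(S^X)$. Then there exists a system $(f_x)_{x\in X}$ of uniformly local functions in $C^0(S^X)$ such that $f=\sum_{x\in X}f_x$ in $C^0_{\mathrm{unif}}(S^X)$.
   Context: Graphs. A symmetric digraph $(X,E)$ is a set $X$ of vertices with a set $E\subset X\times X$ of edges such that $(x,y)\in E$ iff $(y,x)\in E$. It is locally finite if $\{(x,y)\in E\mid y\in X\}$ is finite for every $x\in X$, and connected if any two vertices are joined by a finite path. $d_X$ is the graph distance, $B(x,R):=\{y\in X\mid d_X(x,y)<R\}$, and $\operatorname{diam}(\Lambda):=\sup_{x,y\in\Lambda}d_X(x,y)$ for $\Lambda\subset X$ (with $\operatorname{diam}(\emptyset)=0$). Uniform functions. $S^X:=\prod_{x\in X}S$ is the configuration space. For $\Lambda\subset X$, $C(S^\Lambda)$ is the space of real functions on $S^\Lambda$, viewed as functions on $S^X$ (and on $S^X_*$ below) depending only on the components in $\Lambda$; $C^0(S^\Lambda)$ is its quotient by the constant functions. $\mathscr{I}$ is the set of finite subsets of $X$ (including $\emptyset$). Fix a base state $*\in S$. $S^X_*\subset S^X$ is the set of $\eta$ with $\eta_x=*$ for all but finitely many $x$; $\star$ is the configuration with all components $*$; $C(S^X_* )$ is the space of all functions $S^X_*\to\mathbb{R}$. For $f\in C(S^X_* )$ and $\Lambda\subset X$, $\iota^\Lambda_*f(\eta):=f(\eta|_\Lambda)$, where $\eta|_\Lambda$ agrees with $\eta$ on $\Lambda$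 and equals $*$ outside $\Lambda$. For $\Lambda\in\mathscr{I}$, $C_\Lambda(S^X_* )$ is the space of $f\in C(S^\Lambda)$ such that $\iota^{\Lambda'}_*f=0$ for every finite $\Lambda'\subset X$ with $\Lambda\not\subset\Lambda'$. Every $f\in C(S^X_* )$ has a unique expansion $f=\sum_{\Lambda\in\mathscr{I}}f^*_\Lambda$ with $f^*_\Lambda\in C_\Lambda(S^X_* )$ (a finite sum at each point of $S^X_*$). $f$ is uniform if there is $R>0$ with $f^*_\Lambda=0$ whenever $\operatorname{diam}(\Lambda)>R$. $C_{\mathrm{unif}}(S^X_* )$ is the space of uniform functions and $C^0_{\mathrm{unif}}(S^X_* )$ its quotient by the constant functions. Independence of base state. For base states $*,*'\in S$ there is an $\mathbb{R}$-linear isomorphism $C_{\mathrm{unif}}(S^X_* )\cong C_{\mathrm{unif}}(S^X_{*'})$ sending $f=\sum_\Lambda f^*_\Lambda$ to $\sum_{\Lambda'\in\mathscr{I}}f^{*'}_{\Lambda'}$, where $f^{*'}_\emptyset:=f(\star)$ and, for $\Lambda'\ne\emptyset$, $f^{*'}_{\Lambda'}:=\sum_{\Lambda\in\mathscr{I},\,\Lambda'\subset\Lambda}(f^*_\Lambda)^{*'}_{\Lambda'}$ (a finite sum), with $(f^*_\Lambda)^{*'}_{\Lambda'}$ the components of the expansion of $f^*_\Lambda\in C(S^\Lambda)\subset C(S^X_{*'})$ for the base state $*'$. It induces an isomorphism $C^0_{\mathrm{unif}}(S^X_* )\cong C^0_{\mathrm{unif}}(S^X_{*'})$, and via these identifications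 the space is simply denoted $C^0_{\mathrm{unif}}(S^X)$. Uniformly local systems. A system $(f_x)_{x\in X}$ in $C^0(S^X)$ is uniformly local if there exists $R>0$ such that $f_x\in C^0(S^{B(x,R)})$ for every $x\in X$. For such a system, $\sum_{x\in X}f_x\in C^0_{\mathrm{unif}}(S^X)$ denotes the following: for a base state $*$, take the representatives of $f_x$ with $f_x(\star)=0$; then $\eta\mapsto\sum_{x\in X}f_x(\eta)$ is a finite sum for each $\eta\in S^X_*$ and is a uniform function on $S^X_*$, and $\sum_{x\in X}f_x$ is its class in $C^0_{\mathrm{unif}}(S^X_* )$. *)

(* Defs.v *)
From HB Require Import structures.
From mathcomp Require Import all_boot all_order all_algebra finmap.
From mathcomp Require Import generic_quotient.
From mathcomp Require Import all_classical all_reals ereal.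

Set Implicit Arguments.
Unset Strict Implicit.
Unset Printing Implicit Defensive.

Import Order.TTheory GRing.Theory Num.Theory.

Local Open Scope classical_set_scope.
Local Open Scope ring_scope.
Local Open Scope quotient_scope.

(* A symmetric digraph is a symmetric relation [E : rel X]; loops are allowed. *)
Section graph.
Variables (R : realType) (X : choiceType) (E : rel X).

Definition locally_finite : Prop := forall x, finite_set [set y | E x y].

Definition connected_graph : Prop :=
  forall x y, exists p : seq X, path E x p /\ last x p = y.

(* [path E x p] has [size p] edges; the infimum is attained when [x] and [y]
   are connected, and is [+oo] otherwise. *)
Definition gdist (x y : X) : \bar R :=
  ereal_inf [set ((size p)%:R)%:E | p in [set p | path E x p /\ last x p = y]].

Definition gball (x : X) (r : R) : set X := [set y | (gdist x y < r%:E)%E].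

(* [0] is added to the set so that the diameter of [set0] is [0], not [-oo]. *)
Definition gdiam (A : set X) : \bar R :=
  ereal_sup (0%E |` [set gdist x y | x in A & y in A]).

End graph.

(* [C0 R T] is the space of functions [T -> R] modulo the constants. *)
Section quotient_by_constants.
Variables (R : realType) (T : Type).
Implicit Types f g h : T -> R.

Definition eq_mod_cst f g : bool := `[< exists c : R, forall t, f t = g t + c >].

Lemma eq_mod_cst_refl : reflexive eq_mod_cst.
Proof. by move=> f; apply/asboolP; exists 0 => t; rewrite addr0. Qed.

Lemma eq_mod_cst_sym : symmetric eq_mod_cst.
Proof.
by move=> f g; apply/asboolP/asboolP => -[c fg]; exists (- c) => t;
  rewrite fg addrK.
Qed.

Lemma eq_mod_cst_trans : transitive eq_mod_cst.
Proof.
move=> g f h /asboolP[c fg] /asboolP[d gh]; apply/asboolP.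
by exists (d + c) => t; rewrite fg gh addrA.
Qed.

Canonical eq_mod_cst_equiv :=
  EquivRel eq_mod_cst eq_mod_cst_refl eq_mod_cst_sym eq_mod_cst_trans.

Definition C0 := {eq_quot eq_mod_cst}.

Definition to_C0 (f : T -> R) : C0 := \pi_C0 f.

End quotient_by_constants.

Section configurations.
Variables (S : Type) (X : choiceType).

(* The set $S^X_b$ for the base state [b]. *)
Record fsconf (b : S) := FSConf {
  fsval :> X -> S ;
  fsvalP : finite_set [set x | fsval x <> b] }.

Lemma restr_subproof (b : S) (L : {fset X}) (eta : X -> S) :
  finite_set [set x | (if x \in L then eta x else b) <> b].
Proof.
apply: (sub_finite_set _ (finite_fset L)) => x /=.
by case: (x \in L).
Qed.

(* $\eta|_\Lambda$ *)
Definition restr (b : S) (L : {fset X}) (eta : X -> S) : fsconf b :=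
  FSConf (restr_subproof b L eta).

Definition star (b : S) : fsconf b := restr b fset0 (fun=> b).

End configurations.

Section uniform_functions.
Variables (R : realType) (S : Type) (X : choiceType) (E : rel X).

Section fixed_base_state.
Variable b : S.
Notation conf := (fsconf X b).
Implicit Types (f : conf -> R) (L : {fset X}).

(* $f \in C(S^\Lambda)$, seen inside $C(S^X_b)$ *)
Definition depends_only L f : Prop :=
  forall eta xi : conf, {in L, eta =1 xi} -> f eta = f xi.

(* $\iota^\Lambda_b f$ *)
Definition iota_base L f : conf -> R := fun eta => f (restr b L eta).

(* $f \in C_\Lambda(S^X_b)$ *)
Definition exact_support L f : Prop :=
  depends_only L f /\
  forall L' : {fset X}, ~~ (L `<=` L')%fset -> iota_base L' f = (fun=> 0).

Definition is_expansion f (F : {fset X} -> conf -> R) : Prop :=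
  (forall L, exact_support L (F L)) /\
  forall eta : conf, finite_set [set L | F L eta <> 0] /\
    f eta = \sum_(L \in [set: {fset X}]) F L eta.

(* The unique [F] such that [is_expansion f F]; [component f L] is
   $f^b_\Lambda$. *)
Definition component f : {fset X} -> conf -> R :=
  xget (fun _ _ => 0) [set F | is_expansion f F].

Definition Cunif : set (conf -> R) :=
  [set f | exists2 r : R, 0 < r &
    forall L, (r%:E < gdiam R E [set` L])%E -> component f L = (fun=> 0)].

Definition C0unif : set (C0 R conf) := [set to_C0 f | f in Cunif].

End fixed_base_state.

Section change_of_base_state.
Variables b b' : S.

(* A function in $C(S^\Lambda)$ seen inside $C(S^X_b)$, seen instead inside
   $C(S^X_{b'})$. *)
Definition transport (L : {fset X}) (g : fsconf X b -> R) : fsconf X b' -> R :=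
  fun eta => g (restr b L eta).

(* The components $f^{b'}_{\Lambda'}$ for [f] in $C_{unif}(S^X_b)$. *)
Definition change_component (f : fsconf X b -> R) (L' : {fset X}) :
    fsconf X b' -> R :=
  if L' == fset0 then fun=> f (star X b)
  else fun eta => \sum_(L \in [set L : {fset X} | (L' `<=` L)%fset])
                    component (transport L (component f L)) L' eta.

Definition change_base (f : fsconf X b -> R) : fsconf X b' -> R :=
  fun eta => \sum_(L' \in [set: {fset X}]) change_component f L' eta.

(* The map induced on $C^0_{unif}$. *)
Definition change_base0 (c : C0 R (fsconf X b)) : C0 R (fsconf X b') :=
  to_C0 (change_base (repr c)).

End change_of_base_state.

(* $c \in C^0(S^A)$, seen inside $C^0(S^X)$ *)
Definition C0_depends_only (A : set X) (c : C0 R (X -> S)) : Prop :=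
  exists2 g : (X -> S) -> R,
    (forall eta xi : X -> S, {in A, eta =1 xi} -> g eta = g xi) & to_C0 g = c.

Definition uniformly_local (fx : X -> C0 R (X -> S)) : Prop :=
  exists2 r : R, 0 < r & forall x, C0_depends_only (gball E x r) (fx x).

(* The representative vanishing at the configuration with all components
   [b]. *)
Definition normalized_repr (b : S) (c : C0 R (X -> S)) : (X -> S) -> R :=
  fun eta => repr c eta - repr c (fun=> b).

(* $\sum_{x \in X} f_x$ in $C^0_{unif}(S^X_b)$, for uniformly local [fx]: the
   sum is then finite at each configuration. *)
Definition sum_local (b : S) (fx : X -> C0 R (X -> S)) : C0 R (fsconf X b) :=
  to_C0 (fun eta : fsconf X b =>
    \sum_(x \in [set: X]) normalized_repr b (fx x) eta).

End uniform_functions.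

(* Main.v *)
Require Import Defs.
From mathcomp Require Import finmap generic_quotient.
From mathcomp Require Import all_boot all_order all_algebra.
From mathcomp Require Import all_classical all_reals ereal.

Set Implicit Arguments.
Unset Strict Implicit.
Unset Printing Implicit Defensive.

Import Order.TTheory GRing.Theory Num.Theory.

Local Open Scope classical_set_scope.
Local Open Scope ring_scope.

(** Write [h = \sum_L h_L] for the expansion of a representative [h] of the
    class [f] with respect to [b].  Assign each nonempty finite set [L] to one
    of its points and let [f_x] be the sum of the [h_L] over the sets assigned
    to [x] ([local_part]).  If [h_L] vanishes as soon as [L] has diameter more
    than [r], then every [L] that contributes to [f_x] lies in the ball of
    radius [r + 1] about [x].  Local finiteness makes that ball finite, so only
    finitely many [L] contribute, [f_x] is a function on all of [S^X], and the
    system is uniformly local.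

    The sum of the [f_x] is computed once for every base state [b'].  Let [eta]
    have support [K] with respect to [b'].  A set [L] that misses [K] sees no
    difference between [eta] and the constant configuration [b'], so
    regrouping the sets by the point to which they are assigned gives
    ([sum_local_part])

      \sum_x (f_x(eta) - f_x(b')) = \sum_(L meets K) (h_L(eta) - h_L(b')),

    a finite sum.  For [b' = b] it equals [h(eta) - h(star)], because the
    nonempty sets with [h_L(eta) <> 0] all lie inside the support of [eta]
    ([sum_meeting_same_base]).  For arbitrary [b'] it equals the function
    obtained from [h] by changing the base state, up to the constant
    [h(star)]: the components of that function are sums of components of the
    [h_L], and exchanging the two sums recombines, for each [L], the expansion
    of [h_L] with respect to [b'] ([change_baseE]).

    Both computations rely on the existence and uniqueness of expansions.
    These follow from the characterization [is_expansionP] of an expansion by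
    its partial sums over the subsets of a finite set, which determine the
    components recursively. *)

(** * Restriction of configurations *)

Section restriction.
Context {S : Type} {X : choiceType}.

Lemma fsconf_eq (b : S) (eta xi : fsconf X b) : eta =1 xi -> eta = xi.
Proof.
case: eta xi => [u hu] [v hv] /= /funext uv.
by move: uv hu hv => -> hu hv; rewrite (Prop_irrelevance hu hv).
Qed.

Lemma eq_restr (b : S) (L : {fset X}) (eta xi : X -> S) :
  {in L, eta =1 xi} -> restr b L eta = restr b L xi.
Proof. by move=> e; apply: fsconf_eq => x /=; case: ifP => // /e. Qed.

Lemma restr_in (b : S) (L : {fset X}) (eta : X -> S) :
  {in L, restr b L eta =1 eta}.
Proof. by move=> x /= ->. Qed.

Lemma restr_restr (b : S) (L M : {fset X}) (eta : X -> S) :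
  restr b L (restr b M eta) = restr b (L `&` M)%fset eta.
Proof. by apply: fsconf_eq => x /=; rewrite in_fsetI; case: (x \in L). Qed.

Definition supp (b : S) (eta : fsconf X b) : {fset X} :=
  fset_set [set x | eta x <> b].

Lemma notin_supp (b : S) (eta : fsconf X b) (x : X) :
  x \notin supp eta -> eta x = b.
Proof.
rewrite /supp in_fset_set; last exact: Defs.fsvalP.
by rewrite notin_setE /= => /contrapT.
Qed.

Lemma restr_supp (b : S) (eta : fsconf X b) : restr b (supp eta) eta = eta.
Proof. by apply: fsconf_eq => x /=; case: ifPn => // /notin_supp. Qed.

Lemma star_restr (b : S) (eta : X -> S) : star X b = restr b fset0 eta.
Proof. exact: eq_restr. Qed.

End restriction.

(** * Existence and uniqueness of expansions *)

Section expansion.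
Context {R : realType} {S : Type} {X : choiceType} {b : S}.
Implicit Types (f : fsconf X b -> R) (F : {fset X} -> fsconf X b -> R).
Implicit Types (L M K : {fset X}).

Lemma exact_support_eq0 L M f (eta : X -> S) :
  exact_support L f -> ~~ (L `<=` M)%fset -> f (restr b M eta) = 0.
Proof.
move=> [_ f0] LM; have /(congr1 (fun g => g (restr b M eta))) := f0 _ LM.
by rewrite /iota_base restr_restr fsetIid.
Qed.

Lemma exact_support_supp L f (eta : fsconf X b) :
  exact_support L f -> ~~ (L `<=` supp eta)%fset -> f eta = 0.
Proof. by rewrite -{2}(restr_supp eta); apply: exact_support_eq0. Qed.

(** Evaluating [f] on a configuration restricted to [L] kills every component
    not indexed by a subset of [L]; conversely every configuration is its own
    restriction to its finite support.  This trades the sums of [is_expansion]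
    over all finite sets for sums over power sets. *)
Lemma is_expansionP f F :
  is_expansion f F <->
  (forall L, exact_support L (F L)) /\
  (forall L (eta : fsconf X b),
     \sum_(M <- fpowerset L) F M eta = f (restr b L eta)).
Proof.
split=> -[Fex fE]; split=> //.
  move=> L eta; have [_ ->] := fE (restr b L eta).
  rewrite (fsbigTE (fpowerset L)) => [|M]; last first.
    by rewrite fpowersetE; apply: exact_support_eq0.
  apply: eq_big_seq => M; rewrite fpowersetE => /fsubsetP ML.
  by apply: (Fex M).1 => x /ML xL; rewrite restr_in.
move=> eta.
have F0 M : M \notin fpowerset (supp eta) -> F M eta = 0.
  by rewrite fpowersetE; apply: exact_support_supp.
split; last by rewrite (fsbigTE _ _ F0) fE restr_supp.
apply: (sub_finite_set _ (finite_fset (fpowerset (supp eta)))) => M /= FM.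
by apply/negPn/negP => /F0.
Qed.

(** The partial sums of [is_expansionP] leave one choice for the component at
    [L] once those at the proper subsets of [L] are known.  The argument [n]
    is fuel for this recursion on the cardinality of [L]. *)
Fixpoint increment f (n : nat) L (eta : fsconf X b) : R :=
  f (restr b L eta) -
  (if n is m.+1
   then \sum_(M <- (fpowerset L `\ L)%fset) increment f m M eta else 0).

Lemma incrementS f n L (eta : fsconf X b) :
  increment f n.+1 L eta = f (restr b L eta) -
    \sum_(M <- (fpowerset L `\ L)%fset) increment f n M eta.
Proof. by []. Qed.
Arguments increment : simpl never.

Lemma increment_fuel f n m L (eta : fsconf X b) :
  (#|` L| < n)%N -> (#|` L| < m)%N -> increment f n L eta = increment f m L eta.
Proof.
elim: n m L => [|n IHn] [|m] L //; rewrite !ltnS !incrementS => Ln Lm.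
congr (_ - _); apply: eq_big_seq => M.
rewrite in_fsetD1 fpowersetE -fproperEneq => /fproper_ltn_card ML.
by apply: IHn; apply: leq_trans ML _.
Qed.

Lemma sum_increment f L (eta : fsconf X b) :
  \sum_(M <- fpowerset L) increment f #|` M|.+1 M eta = f (restr b L eta).
Proof.
rewrite (big_fsetD1 L) /=; last by rewrite fpowersetE fsubset_refl.
rewrite incrementS -addrA addrC -[RHS]add0r; congr (_ + _).
apply/eqP; rewrite addrC subr_eq0; apply/eqP; apply: eq_big_seq => M.
rewrite in_fsetD1 fpowersetE -fproperEneq => /fproper_ltn_card ML.
exact: increment_fuel.
Qed.

(** Let [L] be a set not included in [M].  The partial sums over [L] at
    [eta|_M] and over [L `&` M] at [eta] both equal [f] at the same restricted
    configuration.  By induction the proper subsets of [L] contribute to the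
    first exactly what the subsets of [L `&` M] contribute to the second, so
    nothing is left for [L] itself. *)
Lemma exact_support_increment f L :
  exact_support L (increment f #|` L|.+1 L).
Proof.
have dep n M (eta xi : fsconf X b) : {in M, eta =1 xi} ->
    increment f n M eta = increment f n M xi.
  elim: n M => [|n IHn] M e; first by rewrite /increment (eq_restr b e).
  rewrite !incrementS (eq_restr b e).
  congr (_ - _); apply: eq_big_seq => N.
  rewrite in_fsetD1 fpowersetE => /andP[_ /fsubsetP NM].
  by apply: IHn => x /NM /e.
split; first exact: dep.
have [n] := ubnP #|` L|; elim: n L => // n IHn L; rewrite ltnS => Ln M LM.
apply/funext => eta; rewrite /iota_base.
have LMP : (L `&` M `<` L)%fset.
  rewrite fproperEneq fsubsetIl andbT.
  by apply: contra LM => /eqP LME; apply/fsetIidPl.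
have := sum_increment f L (restr b M eta).
rewrite restr_restr -(sum_increment f _ eta).
rewrite (big_fsetD1 L) /=; last by rewrite fpowersetE fsubset_refl.
have -> : \sum_(N <- (fpowerset L `\ L)%fset)
    increment f #|` N|.+1 N (restr b M eta) =
    \sum_(N <- fpowerset (L `&` M)%fset) increment f #|` N|.+1 N eta.
  symmetry; rewrite -[RHS](@big_fset_incl _ _ _ _ (fpowerset (L `&` M)%fset)).
  - apply: eq_big_seq => N; rewrite fpowersetE fsubsetI => /andP[_ /fsubsetP NM].
    by apply: dep => x /NM xM; rewrite restr_in.
  - apply/fsubsetP => N; rewrite in_fsetD1 !fpowersetE -fproperEneq.
    by move=> /fsub_proper_trans; apply.
  - move=> N; rewrite in_fsetD1 !fpowersetE -fproperEneq fsubsetI => NL.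
    rewrite (fproper_sub NL) /= => NM.
    have /(_ _ NM)/(congr1 (fun g => g eta)) := IHn N _ M; apply.
    exact: leq_trans (fproper_ltn_card NL) Ln.
by move=> /(canRL (addrK _)); rewrite subrr.
Qed.

Lemma expansion_unique f F G : is_expansion f F -> is_expansion f G -> F = G.
Proof.
move=> /is_expansionP[_ FE] /is_expansionP[_ GE].
apply/funext => L; apply/funext => eta.
have [n] := ubnP #|` L|; elim: n L => // n IHn L; rewrite ltnS => Ln.
have := FE L eta; rewrite -(GE L eta).
have LL : L \in fpowerset L by rewrite fpowersetE fsubset_refl.
rewrite !(big_fsetD1 L LL) /= => /eqP.
rewrite (eq_big_seq (fun M => G M eta)) => [|M].
  by rewrite (inj_eq (addIr _)) => /eqP.
rewrite in_fsetD1 fpowersetE -fproperEneq => /fproper_ltn_card ML.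
by apply: IHn; apply: leq_trans ML Ln.
Qed.

Lemma componentP f : is_expansion f (component f).
Proof.
apply: (@xgetPex _ _ [set F | is_expansion f F]).
exists (fun L => increment f #|` L|.+1 L); apply/is_expansionP; split.
  exact: exact_support_increment.
exact: sum_increment.
Qed.

Lemma exact_support_component f L : exact_support L (component f L).
Proof. exact: (componentP f).1. Qed.

Lemma sum_component f L (eta : fsconf X b) :
  \sum_(M <- fpowerset L) component f M eta = f (restr b L eta).
Proof. by have /is_expansionP[_] := componentP f; apply. Qed.

Lemma component0 f (eta : fsconf X b) : component f fset0 eta = f (star X b).
Proof.
by rewrite (star_restr b eta) -(sum_component f) fpowerset0 big_seq_fset1.
Qed.

Lemma sum_component_neq0 f L (eta : fsconf X b) :
  \sum_(M <- fpowerset L | M != fset0) component f M eta =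
  f (restr b L eta) - f (star X b).
Proof.
have L0 : fset0 \in fpowerset L by rewrite fpowersetE fsub0set.
rewrite -(sum_component f L) -(component0 f eta).
by rewrite [X in _ = X - _](bigD1_seq fset0) ?fset_uniq //= addrAC subrr add0r.
Qed.

(** Classes modulo constants come with an arbitrary representative, hence the
    need to compare the expansions of functions that differ by a constant. *)
Lemma component_addr_cst f (c : R) L : L != fset0 ->
  component (fun eta => f eta + c) L = component f L.
Proof.
move=> /negPf L0.
pose F M (eta : fsconf X b) := component f M eta + (if M == fset0 then c else 0).
suff /(expansion_unique (componentP _))-> :
    is_expansion (fun eta => f eta + c) F.
  by apply/funext => eta; rewrite /F L0 addr0.
apply/is_expansionP; split=> [M|M eta].
  have [dep ex] := exact_support_component f M.
  split=> [eta xi e|K MK]; first by rewrite /F (dep _ _ e).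
  apply/funext => eta; move: (ex _ MK) => /(congr1 (fun g => g eta)).
  rewrite /iota_base /F => ->; rewrite add0r ifF //.
  by apply: contraNF MK => /eqP ->; apply: fsub0set.
have M0 : fset0 \in fpowerset M by rewrite fpowersetE fsub0set.
rewrite big_split /= sum_component; congr (_ + _).
rewrite (bigD1_seq fset0) ?fset_uniq //= ?eqxx big1 ?addr0 // => K /negPf -> //.
Qed.

End expansion.

(** * Classes modulo constants *)

Section modulo_constants.
Context {R : realType}.

Lemma to_C0P (T : Type) (f g : T -> R) :
  to_C0 f = to_C0 g <-> exists c, forall t, f t = g t + c.
Proof.
have := @eqmodP _ (eq_mod_cst_equiv R T) f g => fgP.
split=> [/fgP/asboolP //|fg]; apply/fgP; exact/asboolP.
Qed.

Lemma repr_to_C0 (T : Type) (f : T -> R) :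
  exists c, forall t, repr (to_C0 f) t = f t + c.
Proof. by apply/to_C0P; rewrite /to_C0 reprK. Qed.

Lemma normalized_repr_to_C0 (S : Type) (X : choiceType) (b : S)
    (g : (X -> S) -> R) (eta : X -> S) :
  normalized_repr b (to_C0 g) eta = g eta - g (fun=> b).
Proof.
have [c gE] := repr_to_C0 g.
by rewrite /normalized_repr !gE opprD addrACA subrr addr0.
Qed.

End modulo_constants.

(** * Distributing an expansion over the points *)

Lemma eq_big_carrier (V : nmodType) (T : choiceType) (A B : {fset T})
    (P : pred T) (G : T -> V) :
  (forall i, P i -> i \notin A -> G i = 0) ->
  (forall i, P i -> i \notin B -> G i = 0) ->
  \sum_(i <- A | P i) G i = \sum_(i <- B | P i) G i.
Proof.
move=> GA GB; transitivity (\sum_(i \in [set` P]) G i).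
  exact: bigfs (fset_uniq A) GA.
by symmetry; apply: bigfs (fset_uniq B) GB.
Qed.

Section local_sum.
Context {R : realType} {S : Type} {X : choiceType} {b : S}.
Variable F : {fset X} -> fsconf X b -> R.
Implicit Types (L K : {fset X}) (x : X).

(** The consequence of uniformity and local finiteness of the graph that makes
    all sums below finite. *)
Definition point_finite : Prop :=
  forall x, finite_set [set L : {fset X} | x \in L /\ F L <> (fun=> 0)].

Definition through x : {fset {fset X}} :=
  fset_set [set L : {fset X} | x \in L /\ F L <> (fun=> 0)].

Definition meeting K : {fset {fset X}} := (\bigcup_(x <- K) through x)%fset.

(** A nonempty [L] is assigned to the first element of its enumeration; any
    choice of a point of [L] would do.  Restricting with [restr b L] extends
    [F L] to configurations of infinite support. *)
Definition local_part x (eta : X -> S) : R :=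
  \sum_(L <- through x | ohead (enum_fset L) == Some x) F L (restr b L eta).

Hypothesis Ffin : point_finite.

Lemma throughP x L : reflect (x \in L /\ F L <> (fun=> 0)) (L \in through x).
Proof.
by rewrite /through in_fset_set ?inE; [exact: asboolP | exact: Ffin].
Qed.

Lemma meetingP K L :
  reflect ((exists2 x, x \in K & x \in L) /\ F L <> (fun=> 0))
          (L \in meeting K).
Proof.
apply: (iffP (bigfcupP _ _ _ _)) => [[x]|[[x xK xL] FL]].
  by rewrite andbT => xK /throughP[xL FL]; split=> //; exists x.
by exists x; [rewrite xK | exact/throughP].
Qed.

Lemma ohead_mem L x : ohead (enum_fset L) = Some x -> x \in L.
Proof.
rewrite -[x \in L]/(x \in enum_fset L).
by case: (enum_fset L) => //= y s [->]; rewrite mem_head.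
Qed.

(** Only the sets that meet the support of [eta] see a difference between
    [eta] and the constant configuration [b'], and each of them is assigned to
    exactly one point. *)
Lemma sum_local_part (b' : S) (eta : fsconf X b') :
  \sum_(x \in [set: X]) (local_part x eta - local_part x (fun=> b')) =
  \sum_(L <- meeting (supp eta))
    (transport L (F L) eta - transport L (F L) (star X b')).
Proof.
set M := meeting _.
pose D L := F L (restr b L eta) - F L (restr b L (fun=> b')).
have D0 L : L \notin M -> D L = 0.
  move=> LM; rewrite /D; have [->|FL] := pselect (F L = (fun=> 0)).
    by rewrite subrr.
  rewrite (@eq_restr _ _ b L eta (fun=> b')) ?subrr // => x xL.
  by apply/notin_supp; apply: contra LM => xK; apply/meetingP; split=> //; exists x.
(* The sets through [x] and the sets in [M] differ, but every [L] assigned to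
   [x] with [D L <> 0] belongs to both. *)
have partE x : local_part x eta - local_part x (fun=> b') =
    \sum_(L <- M | ohead (enum_fset L) == Some x) D L.
  rewrite /local_part -sumrB; apply: eq_big_carrier => L /eqP /ohead_mem xL.
    move=> /throughP Lx; rewrite (_ : F L = (fun=> 0)) ?subrr //.
    by apply: contrapT => FL; apply: Lx.
  exact: D0.
under eq_fsbigr do rewrite partE.
have headM L : L \in M -> exists x, ohead (enum_fset L) = Some x.
  move=> /meetingP[[x _ +] _]; rewrite -[x \in L]/(x \in enum_fset L).
  by case: (enum_fset L) => // y s _; exists y.
rewrite (fsbigTE (\bigcup_(L <- M) L)%fset) => [|x xM]; last first.
  rewrite big_seq_cond big1 // => L /andP[LM /eqP/ohead_mem xL].
  by case/bigfcupP: xM; exists L; rewrite ?LM.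
rewrite (exchange_big_dep predT) //=; apply: eq_big_seq => L LM.
have [y Ly] := headM L LM.
rewrite (eq_bigl (fun x => x == y)) => [|x]; last by rewrite Ly eq_sym.
have yM : y \in (\bigcup_(L <- M) L)%fset.
  by apply/bigfcupP; exists L; [rewrite LM | exact: ohead_mem].
rewrite big_mkcond (bigD1_seq y) ?fset_uniq //= eqxx big1 => [|x /negPf-> //].
by rewrite addr0 /D /transport; congr (_ - F L _); apply: eq_restr.
Qed.

End local_sum.

(** * Summing over the sets that meet a support *)

Section expansion_of_function.
Context {R : realType} {S : Type} {X : choiceType} {b : S}.
Variable h : fsconf X b -> R.
Hypothesis hfin : point_finite (component h).

(** With the original base state the subtracted terms vanish, since a component
    at a nonempty set is zero at [star], and what remains is the expansion of
    [h] at [eta] without its constant term. *)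
Lemma sum_meeting_same_base (eta : fsconf X b) :
  \sum_(L <- meeting (component h) (supp eta))
    (transport L (component h L) eta - transport L (component h L) (star X b))
  = h eta - h (star X b).
Proof.
rewrite -{3}(restr_supp eta) -sum_component_neq0.
have nz L : L \in meeting (component h) (supp eta) -> L != fset0.
  move=> /(meetingP hfin)[[x _ xL] _].
  by apply: contraTneq xL => ->; rewrite in_fset0.
transitivity (\sum_(L <- meeting (component h) (supp eta) | L != fset0)
    component h L eta).
  rewrite big_seq_cond [RHS]big_seq_cond.
  apply: eq_big => [L|L /andP[/nz L0 _]].
    by rewrite andbT; case: (boolP (L \in _)) => //= /nz ->.
  have hL := exact_support_component h L.
  rewrite /transport [X in X - _](hL.1 _ eta); last exact: restr_in.
  rewrite restr_restr fsetI0 (exact_support_eq0 _ hL) ?subr0 //.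
  by rewrite fsubset0.
apply: eq_big_carrier => L L0; last first.
  by rewrite fpowersetE; apply/exact_support_supp/exact_support_component.
move=> /(meetingP hfin) LM; have hL := exact_support_component h L.
have [->//|FL] := pselect (component h L = (fun=> 0)).
apply: (exact_support_supp hL); apply/negP => /fsubsetP LK.
apply: LM; split=> //; have /fset0Pn[x xL] := L0.
by exists x => //; apply: LK.
Qed.

Lemma component_zero (b' : S) (L : {fset X}) :
  component (fun _ : fsconf X b' => 0 : R) L = (fun=> 0).
Proof.
suff /(expansion_unique (componentP _)) -> :
  is_expansion (fun _ : fsconf X b' => 0 : R) (fun _ _ => 0) by [].
by apply/is_expansionP; split=> // *; rewrite big1.
Qed.

(** The double sum defining [change_base h eta] runs over nonempty subsets [L']
    of the support of [eta] and over sets [L] containing [L'], which thus meet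
    this support.  After the exchange, the inner sum over [L'] is a partial sum
    of the expansion of [component h L] with respect to [b']. *)
Lemma change_baseE (b' : S) (eta : fsconf X b') :
  change_base h eta = h (star X b) +
  \sum_(L <- meeting (component h) (supp eta))
    (transport L (component h L) eta
     - transport L (component h L) (star X b')).
Proof.
set K := supp eta; set M := meeting _ _; rewrite /change_base.
rewrite (fsbigTE (fpowerset K)) => [|L']; last first.
  rewrite fpowersetE => L'K; rewrite /change_component ifF; last first.
    by apply: contraNF L'K => /eqP ->; apply: fsub0set.
  apply: fsbig1 => L _; apply: exact_support_supp L'K.
  exact: exact_support_component.
rewrite (bigD1_seq fset0) ?fset_uniq ?fpowersetE ?fsub0set //=.
congr (_ + _).
transitivity (\sum_(L' <- fpowerset K | L' != fset0)
   \sum_(L <- M | (L' `<=` L)%fset)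
     component (transport L (component h L)) L' eta).
  rewrite big_seq_cond [RHS]big_seq_cond; apply: eq_bigr => L'.
  rewrite fpowersetE => /andP[/fsubsetP L'K L'0].
  rewrite /change_component (negPf L'0) [RHS]bigfs ?fset_uniq // => L /fsubsetP L'L LM.
  have -> : component h L = (fun=> 0); last by rewrite component_zero.
  apply: contrapT => hL; move/negP: LM; apply; apply/(meetingP hfin).
  by split=> //; have /fset0Pn[x xL'] := L'0; exists x; [apply: L'K|apply: L'L].
rewrite (exchange_big_dep predT) //=; apply: eq_bigr => L _.
set T := transport L _.
transitivity (\sum_(L' <- fpowerset (K `&` L)%fset | L' != fset0)
    component T L' eta).
  rewrite -big_filter -[RHS]big_filter; apply: perm_big.
  apply: uniq_perm; rewrite ?filter_uniq ?fset_uniq // => L'.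
  by rewrite !mem_filter !fpowersetE fsubsetI -andbA [(_ `<=` L)%fset && _]andbC.
rewrite sum_component_neq0; congr (_ - _); rewrite /T /transport.
congr (component h L _); apply: eq_restr => x xL /=.
by rewrite in_fsetI xL andbT; case: ifPn => // xK; rewrite (notin_supp xK).
Qed.

End expansion_of_function.

(** * Balls in a locally finite graph *)

Section graph.
Context {R : realType} {X : choiceType} {E : rel X}.

Lemma gdist_lt_path (x y : X) (r : R) : (gdist R E x y < r%:E)%E ->
  exists p, [/\ path E x p, last x p = y & (size p)%:R < r].
Proof.
move=> /ereal_inf_lt[_ [p [xp py] <-]]; rewrite lte_fin => pr.
by exists p.
Qed.

Lemma finite_walk_ends (E_lf : locally_finite E) (n : nat) (x : X) :
  finite_set [set y | exists p, [/\ path E x p, last x p = y & (size p <= n)%N]].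
Proof.
elim: n x => [|n IHn] x.
  apply: (sub_finite_set _ (finite_set1 x)) => y [p [_ <-]].
  by rewrite leqn0 size_eq0 => /eqP ->.
apply: (sub_finite_set _ (_ : finite_set ([set x] `|`
   \bigcup_(z in [set z | E x z])
     [set y | exists p, [/\ path E z p, last z p = y & (size p <= n)%N]]))).
  move=> y [[|z p] /= [xp py pn]]; first by left.
  by move: xp => /andP[xz zp]; right; exists z => //; exists p.
rewrite finite_setU; split; first exact: finite_set1.
by apply: bigcup_finite => [|z _]; [exact: E_lf | exact: IHn].
Qed.

Lemma finite_gball (E_lf : locally_finite E) (x : X) (r : R) :
  finite_set (gball E x r).
Proof.
apply: (sub_finite_set _ (finite_walk_ends E_lf (Num.trunc r) x)).
move=> y /gdist_lt_path[p [xp py pr]]; exists p; split=> //.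
by rewrite -ltnS -(ltr_nat R); apply: lt_trans pr (truncnS_gt _).
Qed.

Lemma gdiam_gball (A : set X) (x y : X) (r : R) :
  (gdiam R E A <= r%:E)%E -> A x -> A y -> gball E x (r + 1) y.
Proof.
move=> Ar Ax Ay; rewrite /gball /=; apply: (@le_lt_trans _ _ r%:E).
  by apply: le_trans Ar; apply: ereal_sup_ubound; right; exists x => //; exists y.
by rewrite lte_fin ltrDl.
Qed.

Lemma finite_fsubsets (A : set X) :
  finite_set A -> finite_set [set L : {fset X} | [set` L] `<=` A].
Proof.
move=> Afin; apply: (sub_finite_set _ (finite_fset (fpowerset (fset_set A)))).
move=> L /= LA; rewrite fpowersetE; apply/fsubsetP => x /LA Ax.
by rewrite in_fset_set // inE.
Qed.

End graph.

(** * Decomposition into local functions *)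

Theorem proposition2p10 (R : realType) (S : Type) (X : choiceType) (E : rel X)
    (E_sym : symmetric E) (E_conn : connected_graph E)
    (E_lf : locally_finite E)
    (b : S) (f : C0 R (fsconf X b)) (f_unif : C0unif E f) :
  exists fx : X -> C0 R (X -> S),
    uniformly_local E fx /\
    f = sum_local b fx /\
    (forall b' : S, change_base0 b' f = sum_local b' fx).
Proof.
have [g [r r0 gr] gf] := f_unif; pose h := repr f.
have hC : to_C0 h = f by rewrite /to_C0 reprK.
have /to_C0P[c hg] : to_C0 h = to_C0 g by rewrite hC gf.
(* The extra [1] is there because balls are open while the bound on diameters
   is not strict. *)
have sub_ball x L : x \in L -> component h L <> (fun=> 0) ->
    [set` L] `<=` gball E x (r + 1).
  move=> xL hL y yL; apply: (gdiam_gball (A := [set` L])) => //.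
  rewrite leNgt; apply/negP => /gr gL; apply: hL.
  rewrite (_ : h = fun eta => g eta + c); last exact/funext.
  by rewrite component_addr_cst //; apply: contraTneq xL => ->.
have hfin : point_finite (component h).
  move=> x; apply: (sub_finite_set _
    (finite_fsubsets (finite_gball (R := R) E_lf x (r + 1)))).
  by move=> L [xL hL]; apply: sub_ball.
pose fx x := to_C0 (local_part (component h) x).
have sumE b' (eta : fsconf X b') :
    \sum_(x \in [set: X]) normalized_repr b' (fx x) eta =
    \sum_(L <- meeting (component h) (supp eta))
      (transport L (component h L) eta
       - transport L (component h L) (star X b')).
  rewrite -sum_local_part //; apply: eq_fsbigr => x _.
  exact: normalized_repr_to_C0.
exists fx; split; [|split=> [|b']].
- exists (r + 1); first by rewrite ltr_wpDr.
  move=> x; exists (local_part (component h) x) => // eta xi e.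
  rewrite /local_part big_seq_cond [RHS]big_seq_cond.
  apply: eq_bigr => L /andP[/(throughP hfin)[xL hL] _].
  congr (component h L _); apply: eq_restr => y yL.
  by apply: e; rewrite inE; apply: sub_ball yL.
- rewrite -hC; apply/to_C0P; exists (h (star X b)) => eta.
  by rewrite sumE sum_meeting_same_base // subrK.
- apply/to_C0P; exists (h (star X b)) => eta.
  by rewrite sumE change_baseE // addrC.
Qed.
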